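(* Let $G$ be a finite group and $N$ a normal subgroup of $G$. Then the right regular representation of $G$ is self-normalizing in $W(G,N)$ if and only if (1) $Z(N) \le Z(G)$, and (2) the order of the abelianization of $G/N$ is relatively prime to $|Z(N)|$.
   Context: Let $\overline{\phantom{x}}\colon G \to G/N$ be the natural homomorphism. For $c \in G$ and any function $f\colon G/N \to N$, let $\varphi_{c,f}$ be the permutation of $G$ given by $\varphi_{c,f}(x) = x c\, f(\overline{x})$. $W(G,N)$ is the set of all such permutations $\varphi_{c,f}$; it is a subgroup of the symmetric group on $G$ containing the right regular representation of $G$ (the action of $G$ on itself by right multiplication). $Z(\cdot)$ denotes the center. *)

(* Defs.v *)
From mathcomp Require Import all_boot all_fingroup all_solvable.

Set Implicit Arguments.
Unset Strict Implicit.
Unset Printing Implicit Defensive.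

Import GroupScope.

(* The finite group G is the whole of a finGroupType gT, so that permutations
   of G are {perm gT} and, when N is normal, G / N is the type coset_of N.
   Products of permutations are read left to right: (s * t) x = t (s x). *)

Definition phi (gT : finGroupType) (N : {group gT}) (c : gT)
    (f : {ffun coset_of N -> subg_of N}) (x : gT) : gT :=
  x * c * sgval (f (coset N x)).

Definition W (gT : finGroupType) (N : {group gT}) : {set {perm gT}} :=
  [set s : {perm gT} |
    [exists c : gT, exists f : {ffun coset_of N -> subg_of N},
      [forall x : gT, s x == phi c f x]]].

Definition right_regular (gT : finGroupType) : {group {perm gT}} :=
  (actperm 'R @* [set: gT])%G.

Lemma coset_phi (gT : finGroupType) (N : {group gT}) (c : gT)
    (f : {ffun coset_of N -> subg_of N}) (x : gT) :
  N <| [set: gT] -> coset N (phi c f x) = coset N x * coset N c.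
Proof.
move=> /normal_norm/subsetP nN.
have nNx z : z \in 'N(N) by apply: nN; rewrite inE.
by rewrite /phi !morphM //= [coset N (sgval _)]coset_id ?subgP // mulg1.
Qed.

(* Every phi c f is a permutation of G, so that restricting to permutations in
   the definition of W discards none of them. *)
Lemma phi_inj (gT : finGroupType) (N : {group gT}) (c : gT)
    (f : {ffun coset_of N -> subg_of N}) :
  N <| [set: gT] -> injective (phi c f).
Proof.
move=> nNG x y e; have cE := coset_phi c f _ nNG.
have exy : coset N x = coset N y.
  by apply: (mulIg (coset N c)); rewrite -!cE e.
by move: e; rewrite /phi exy => /mulIg /mulIg.
Qed.

Lemma W_group_set (gT : finGroupType) (N : {group gT}) :
  N <| [set: gT] -> group_set (W N).
Proof.
move=> nNG; have /subsetP nN := normal_norm nNG.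
apply/group_setP; split.
  rewrite inE; apply/existsP; exists 1; apply/existsP.
  exists [ffun=> 1]; apply/forallP => x.
  by rewrite /phi ffunE perm1 !mulg1.
move=> s t; rewrite !inE.
move=> /existsP[c /existsP[f /forallP sE]] /existsP[d /existsP[g /forallP tE]].
apply/existsP; exists (c * d); apply/existsP.
exists [ffun u => subg N (sgval (f u) ^ d * sgval (g (u * coset N c)))].
apply/forallP => x; rewrite permM (eqP (sE x)) (eqP (tE _)).
rewrite {1}/phi coset_phi // /phi ffunE subgK; last first.
  by rewrite groupM ?subgP // memJ_norm ?subgP // nN ?inE.
by rewrite conjgE !mulgA mulgK.
Qed.

Lemma right_regular_sub_W (gT : finGroupType) (N : {group gT}) :
  right_regular gT \subset W N.
Proof.
apply/subsetP => _ /morphimP[g _ _ ->]; rewrite inE.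
apply/existsP; exists g; apply/existsP; exists [ffun=> 1].
by apply/forallP => x; rewrite /phi ffunE actpermE /= mulg1.
Qed.

(* Main.v *)
(* Since W contains the right regular representation R, the normaliser of R in
   W equals R iff the only automorphism of G lying in W is 1. An automorphism s
   in W is x |-> x d(xN) with d a crossed homomorphism G / N -> Z(N), and every
   such d arises, so R is self-normalising iff Z^1(G / N, Z(N)) = 1. Triviality
   of the coboundaries means Z(N) <= Z(G); then Z^1 = Hom(G / N, Z(N)), which is
   trivial iff the orders of the abelianisation of G / N and of Z(N) are
   coprime. *)
Require Import Defs.
From mathcomp Require Import all_boot all_fingroup all_solvable.
Import GroupScope.

(** With p = [#[z]], a maximal subgroup of a nontrivial p-group is normal of index p, so the
    quotient by it is cyclic of order p. *)
Lemma pgroup_homg_cycle (gT rT : finGroupType) (P : {group gT}) (z : rT) :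
  #[z].-group P -> prime #[z] -> P :!=: 1 -> <[z]> \homg P.
Proof.
move=> pP prz ntP.
have [M maxM _] : {M : {group gT} | maximal M P & [1 gT] \subset M}.
  by apply: maxgroup_exists; rewrite proper1G.
have nMP := normal_norm (p_maximal_normal pP maxM).
have cardPM : #|P / M| = #[z].
  by rewrite card_quotient // (p_maximal_index pP maxM).
apply: homg_trans (quotient_homg nMP); apply: isog_hom.
by rewrite isog_cyclic_card ?cycle_cyclic // prime_cyclic cardPM ?eqxx.
Qed.

(** With p = [#[z]], dividing the abelianization [A] by its p'-core, a Hall subgroup since [A] is
    nilpotent, leaves a p-group of order the p-part of [|A|]. It is nontrivial, hence maps onto
    [<[z]>]. *)
Lemma homg_cycle_abelianization (gT rT : finGroupType) (G : {group gT})
    (z : rT) :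
  prime #[z] -> #[z] %| #|G / G^`(1)| -> <[z]> \homg G.
Proof.
move=> prz dvz; set A := (G / G^`(1))%G.
have nilA : nilpotent A by apply: abelian_nil; exact: der_abelian 0 G.
have hallA := nilpotent_pcore_Hall #[z]^' nilA.
have nOA : A \subset 'N('O_#[z]^'(A)) by exact: gFnorm.
have cardAO : #|A / 'O_#[z]^'(A)| = (#|A|`_#[z])%N.
  by rewrite card_quotient // -divgS ?pcore_sub // (card_Hall hallA)
    -[X in (X %/ _)%N](partnC #[z] (cardG_gt0 A)) mulnK.
apply: homg_trans (quotient_homg (der_norm 1 G)).
apply: homg_trans (quotient_homg nOA).
apply: pgroup_homg_cycle => //; first by rewrite /pgroup cardAO part_pnat.
rewrite -cardG_gt1 cardAO p_part -[ltnLHS](expn0 #[z]) ltn_exp2l ?prime_gt1 //.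
by rewrite logn_gt0 mem_primes prz cardG_gt0.
Qed.

Lemma abelian_homg_coprime_trivg (aT rT : finGroupType) (G : {group aT})
    (H : {group rT}) :
  H \homg G -> abelian H -> coprime #|G / G^`(1)| #|H| -> H :=: 1.
Proof.
case/homgP=> f <- abfG coGH; apply: card1_trivg.
have sG'K : G^`(1) \subset 'ker f.
  rewrite -sub_morphim_pre ?der_sub // morphim_der //.
  by rewrite (derG1P abfG).
have dvdH : #|f @* G| %| #|G / G^`(1)|.
  by rewrite card_morphim setIid card_quotient ?der_norm ?indexgS.
by move: (coprime_dvdl dvdH coGH); rewrite /coprime gcdnn => /eqP.
Qed.

Section RightRegular.

Variables (gT : finGroupType) (N : {group gT}).
Hypothesis nNG : N <| [set: gT].

Implicit Types (s : {perm gT}) (x y : gT).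

Let nN x : x \in 'N(N).
Proof. by apply: (subsetP (normal_norm nNG)); rewrite inE. Qed.

Lemma right_regularP s :
  reflect (exists g, forall x, s x = x * g) (s \in right_regular gT).
Proof.
apply: (iffP morphimP) => [[g _ _ ->]|[g sE]].
  by exists g => x; rewrite actpermE.
by exists g; rewrite ?inE //; apply/permP => x; rewrite actpermE sE.
Qed.

(** Conjugating translation by [y] by [s] sends [s z] to [s (z * y)]. If this is translation by some
    [g], then [z = 1] gives [g = s y]. *)
Lemma mem_norm_right_regular s :
  s 1 = 1 -> (s \in 'N(right_regular gT)) <-> {morph s : x y / x * y}.
Proof.
move=> s1; split=> [nRs x y | sM].
  have : actperm 'R y ^ s \in right_regular gT.
    by rewrite memJ_norm //; apply/right_regularP; exists y => z;
      rewrite actpermE.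
  case/right_regularP=> g sE.
  have sD z : s (z * y) = s z * g by rewrite -sE permJ actpermE.
  by rewrite sD; have := sD 1; rewrite s1 !mul1g => ->.
rewrite inE; apply/subsetP=> _ /imsetP[t /right_regularP[g tE] ->].
apply/right_regularP; exists (s g) => x.
by rewrite -{1}(permKV s x) permJ tE sM permKV.
Qed.

Lemma mem_W1 s :
  s 1 = 1 ->
  (s \in W N) <->
  (forall x, x^-1 * s x \in N) /\
  (forall x y, coset N x = coset N y -> x^-1 * s x = y^-1 * s y).
Proof.
move=> s1; split=> [|[sN s_const]]; rewrite inE.
  case/existsP=> c /existsP[f /forallP sE].
  have sE' x : x^-1 * s x = c * sgval (f (coset N x)).
    by rewrite (eqP (sE x)) /phi -mulgA mulKg.
  (* At [x = 1] the formula reads [c * f(N) = 1], so the constant [c] can be absorbed into [f]; the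
     converse accordingly takes [c = 1]. *)
  have cN : c \in N.
    have := sE' 1; rewrite s1 mulg1 invg1 => /esym/(canRL (mulgK _)) ->.
    by rewrite mul1g groupV subgP.
  by split=> [x|x y exy]; rewrite !sE' ?exy // groupM ?subgP.
apply/existsP; exists 1; apply/existsP.
exists [ffun u : coset_of N => subg N ((repr u)^-1 * s (repr u))].
apply/forallP=> x; rewrite /phi ffunE subgK // mulg1.
by rewrite (s_const _ x) ?coset_reprK ?mulKVg.
Qed.

Lemma norm_right_regular_eq :
  'N_(W N)(right_regular gT) = right_regular gT :> {set {perm gT}} <->
  (forall s, s \in W N -> {morph s : x y / x * y} -> s = 1).
Proof.
have morph1 s : {morph s : x y / x * y} -> s 1 = 1.
  by move=> sM; apply: (mulgI (s 1)); rewrite -sM !mulg1.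
split=> [eqR s sW sM | triv].
  have : s \in right_regular gT.
    by rewrite -eqR inE sW /=; apply/mem_norm_right_regular;
      first exact: morph1.
  case/right_regularP=> g sE; apply/permP => x.
  by rewrite perm1 sE; have := sE 1; rewrite morph1 // mul1g => <-;
    rewrite mulg1.
apply/eqP; rewrite eqEsubset subsetI right_regular_sub_W normG !andbT.
apply/subsetP=> s /setIP[sW sR].
(* Following [s] by translation by [(s 1)^-1] gives a permutation fixing 1, still in [W N] and in
   the normaliser, hence an automorphism. *)
have rR : actperm 'R (s 1)^-1 \in right_regular gT.
  by apply/right_regularP; exists (s 1)^-1 => x; rewrite actpermE.
rewrite -(groupMr s rR) (_ : s * _ = 1) ?group1 //.
apply: triv.
  apply: (@groupM _ (group (W_group_set nNG))) => //.
  exact: (subsetP (right_regular_sub_W N)).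
apply/mem_norm_right_regular; first by rewrite permM actpermE /= mulgV.
by rewrite groupM // (subsetP (normG _)).
Qed.

Lemma coset_eqP x y :
  reflect (exists2 n, n \in N & x = n * y) (coset N x == coset N y).
Proof.
apply: (iffP eqP) => [/rcoset_kercosetP|[n nNn ->]].
  by rewrite !nN => /(_ isT isT) /rcosetP.
by rewrite morphM //= coset_id // mul1g.
Qed.

(* The second half twists the identity by a homomorphism from G / N onto a
   subgroup of prime order of Z(N). *)
Lemma trivial_W_morph_center_coprime :
  (forall s, s \in W N -> {morph s : x y / x * y} -> s = 1) ->
  'Z(N) \subset 'Z([set: gT]) /\
  coprime #|([set: gT] / N) / ([set: gT] / N)^`(1)| #|'Z(N)|.
Proof.
move=> triv.
have sZ : 'Z(N) \subset 'Z([set: gT]).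
  apply/subsetP=> z /centerP[zN zC]; apply/centerP; split=> [|y _].
    by rewrite inE.
  (* Conjugation by [z] lies in [W N]: [x^-1 * x ^ z = (z^-1) ^ x * z] is in [N] and, as [z]
     centralises [N], depends only on the coset of [x]. These are the coboundaries. *)
  suff s1 : perm (conjg_inj z) = 1.
    by apply/esym/commgP/conjg_fixP; rewrite -[RHS](perm1 y) -s1 permE.
  apply: triv; last by move=> a b; rewrite !permE conjMg.
  apply/mem_W1; first by rewrite permE conj1g.
  split=> [a|a b /eqP/coset_eqP[n nNn ->]]; rewrite !permE -!commgEl !commgEr.
    by rewrite groupM // memJ_norm ?groupV.
  by rewrite conjgM conjVg [z ^ n]conjgE zC // mulKg.
split=> //; apply: contraT => ncop.
rewrite /coprime in ncop; set d := gcdn _ _ in ncop.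
have prp : prime (pdiv d).
  by apply: pdiv_prime; rewrite ltn_neqAle eq_sym ncop gcdn_gt0 !cardG_gt0.
have /andP[dvQ dvZ] : (pdiv d %| #|([set: gT] / N) / ([set: gT] / N)^`(1)|)
    && (pdiv d %| #|'Z(N)|) by rewrite -dvdn_gcd pdiv_dvd.
have [z zZ oz] := Cauchy prp dvZ; rewrite -oz in prp dvQ.
have /homgP[f fE] := homg_cycle_abelianization _ _ _ z prp dvQ.
have memQ x : coset N x \in [set: gT] / N by rewrite mem_quotient ?inE.
have fZ x : f (coset N x) \in 'Z(N).
  have : f (coset N x) \in <[z]> by rewrite -fE mem_morphim.
  by apply/subsetP; rewrite cycle_subG.
have fN x : f (coset N x) \in N by apply: (subsetP (center_sub N)).
pose t x := x * f (coset N x).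
have cost x : coset N (t x) = coset N x.
  by rewrite morphM //= [coset N (f _)]coset_id ?mulg1.
have t_inj : injective t.
  move=> x y e; have exy : coset N x = coset N y by rewrite -cost e cost.
  by move: e; rewrite /t exy => /mulIg.
have s1 : perm t_inj = 1.
  apply: triv => [|x y]; last first.
    rewrite !permE /t morphM //= morphM //=.
    have /centerP[_ fC] := subsetP sZ _ (fZ x).
    by rewrite !mulgA; congr (_ * _); rewrite -!mulgA fC ?inE.
  apply/mem_W1; first by rewrite permE /t morph1 /= morph1 mulg1.
  by split=> [x|x y exy]; rewrite !permE /t !mulKg ?exy.
have : z \in f @* ([set: gT] / N) by rewrite fE cycle_id.
case/morphimP=> _ _ /morphimP[x _ _ ->] zE.
(* At an [x] whose coset [f] sends to [z], triviality of the twist forces [z = 1], against its prime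
   order. *)
have := permE t_inj x; rewrite s1 perm1 /t => /esym/(canRL (mulKg _)).
by rewrite mulVg -zE => z1; move: prp; rewrite z1 order1.
Qed.

Lemma center_coprime_trivial_W_morph s :
  'Z(N) \subset 'Z([set: gT]) ->
  coprime #|([set: gT] / N) / ([set: gT] / N)^`(1)| #|'Z(N)| ->
  s \in W N -> {morph s : x y / x * y} -> s = 1.
Proof.
move=> sZ co sW sM.
have s1 : s 1 = 1 by apply: (mulgI (s 1)); rewrite -sM !mulg1.
have [dN d_const] := (mem_W1 _ s1).1 sW.
pose d x := x^-1 * s x.
have dNx n x : n \in N -> d (n * x) = d x.
  by move=> nNn; apply/d_const/eqP/coset_eqP; exists n.
have sd x : s x = x * d x by rewrite mulKVg.
have d1 : d 1 = 1 by rewrite /d s1 invg1 mulg1.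
have sfix n : n \in N -> s n = n.
  by move=> nNn; rewrite sd -[n in d n]mulg1 dNx // d1 mulg1.
(* For [n] in [N], [x * n] lies in the coset of [x], so [d (x * n) = d x]; since [s] fixes [n], also
   [d (x * n) = n^-1 * d x * n]. *)
have dZ x : d x \in 'Z(N).
  apply/centerP; split=> [|n nNn]; first exact: dN.
  have nx : n ^ x^-1 \in N by rewrite memJ_norm.
  have : d (x * n) = d x.
    by rewrite -(dNx _ x nx) conjgE invgK !mulgA mulgKV.
  rewrite {1}/d sM (sfix n) // invMg -!mulgA (mulgA x^-1) -/(d x).
  by move/(canRL (mulKVg _)).
(* The crossed rule [d (x * y) = y^-1 * d x * s y] becomes multiplicativity because [d x] is central
   in the whole group. *)
have dM : {in [set: gT] &, {morph d : x y / x * y}}.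
  move=> x y _ _; have /centerP[_ dC] := subsetP sZ _ (dZ x).
  rewrite {1}/d sM invMg -mulgA (mulgA x^-1) -/(d x).
  by rewrite (dC (s y)) ?(dC (d y)) ?inE // mulgA.
pose f := Morphism dM.
have sNK : N \subset 'ker f.
  apply/subsetP=> n nNn; apply/kerP; rewrite ?inE //=.
  by rewrite /d sfix // mulVg.
have sfZ : f @* [set: gT] \subset 'Z(N).
  by apply/subsetP=> _ /morphimP[x _ _ ->]; exact: dZ.
have f1 : f @* [set: gT] = 1.
  have abf := abelianS sfZ (center_abelian N).
  (* Being trivial on [N], [d] factors through the quotient by [N], whose abelianization the
     coprimality hypothesis concerns. *)
  apply: (@abelian_homg_coprime_trivg _ _ ([set: gT] / N)%G _ _ abf).
    have sker : 'ker (coset N) \subset 'ker f by rewrite ker_coset.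
    apply/homgP; exists [morphism of factm sker (normal_norm nNG)].
    by rewrite morphim_factm.
  exact: coprime_dvdr (cardSg sfZ) co.
apply/permP=> x; rewrite perm1 sd.
suff /set1P -> : d x \in [1 gT] by rewrite mulg1.
by rewrite -[[1 gT]]f1; apply: (mem_morphim f); rewrite inE.
Qed.

End RightRegular.

Theorem theorem4p9 (gT : finGroupType) (N : {group gT})
    (nNG : N <| [set: gT]) :
  'N_(W N)(right_regular gT) = right_regular gT :> {set {perm gT}} <->
  'Z(N) \subset 'Z([set: gT]) /\
  coprime #|([set: gT] / N) / ([set: gT] / N)^`(1)| #|'Z(N)|.
Proof.
apply: iff_trans (norm_right_regular_eq _ _ nNG) _; split.
  exact: trivial_W_morph_center_coprime.
by case=> sZ co s; apply: center_coprime_trivial_W_morph.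
Qed.
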